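(* Let $p\ge5$ be prime and $a,b\in\mathbb{Z}$. Let $R=\#\{x\in\mathbb{F}_p : x^3+ax+b=0\}$, let $\bar a=a\bmod p$, $\bar b=b\bmod p$, and put \[ Q=2^{p^2},\qquad H=(Q^3+\bar aQ+\bar b)^{p-1}. \] Then \[ R=\left(1+\left(\left\lfloor H/Q^{p-1}\right\rfloor\bmod Q\right)+\left(\left\lfloor H/Q^{2(p-1)}\right\rfloor\bmod Q\right)\right)\bmod p. \]
   Context: $x\bmod y$ denotes the least nonnegative residue. *)

(* Defs.v *)
From mathcomp Require Export all_boot all_order all_algebra.

(* Main.v *)
Require Import Defs.
From mathcomp Require Import all_boot all_order all_algebra.
From mathcomp Require Import finfield.
Import GRing.Theory.
Local Open Scope ring_scope.

(** For f = X^3 + a X + b over F_p, the number of roots is congruent to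
    - \sum_x f(x)^(p-1) mod p. The power sum \sum_x x^k is -1 when k is a positive
    multiple of p - 1 and 0 otherwise, so the count is the sum of the coefficients
    of f^(p-1) of degree p-1, 2(p-1) and 3(p-1), the last one being 1. Lifting f
    to natural coefficients in [0, p), all coefficients of f^(p-1) are bounded by
    f(1)^(p-1) <= (2p)^(p-1) < Q, hence they are the base-Q digits of
    f(Q)^(p-1). *)

(** No carries occur: in Horner form the value at [Q] is [g.[Q] * Q + c] with [c < Q], so dividing
    by [Q] drops exactly the constant coefficient. *)
Lemma horner_digit (g : {poly nat}) (Q k : nat) :
  (forall i, ((g`_i)%R < Q)%N) -> ((g.[Q] %/ Q ^ k) %% Q)%N = g`_k.
Proof.
elim/poly_ind: g k => [|g c IHg] k ltQ; first by rewrite horner0 div0n mod0n coef0.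
have c_lt : (c < Q)%N by have := ltQ 0%N; rewrite coefD coefMX coefC /= add0r.
have Q_gt0 : (0 < Q)%N by apply: leq_ltn_trans c_lt.
have gE i : (g * 'X + c%:P)`_i.+1 = g`_i by rewrite coefD coefMX coefC /= addr0.
rewrite hornerMXaddC -[_ + c]/(g.[Q] * Q + c)%N; case: k => [|k].
  by rewrite expn0 divn1 coefD coefMX coefC /= add0r modnMDl modn_small.
by rewrite gE expnS divnMA divnMDl // (divn_small c_lt) addn0 IHg // => i; rewrite -gE.
Qed.

(** Evaluation at 1 adds up all the coefficients, and these are natural numbers. *)
Lemma coef_le_horner1 (g : {poly nat}) (k : nat) : ((g`_k)%R <= g.[1%R])%N.
Proof.
elim/poly_ind: g k => [|g c IHg] [|k]; rewrite ?coef0 //.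
  by rewrite hornerMXaddC coefD coefMX coefC /= add0r leq_addl.
by rewrite hornerMXaddC coefD coefMX coefC /= addr0 mulr1 (leq_trans (IHg k)) ?leq_addr.
Qed.

Lemma big_nat_dvd (R : nmodType) (E : nat -> R) (q m : nat) : (0 < q)%N ->
  \sum_(0 <= k < (m * q).+1 | (0 < k)%N && (q %| k)%N) E k
    = \sum_(1 <= j < m.+1) E (j * q)%N.
Proof.
move=> q_gt0; rewrite -big_filter -(big_map (fun j => j * q)%N predT E).
apply: perm_big; apply: uniq_perm => [||k].
- by rewrite filter_uniq ?iota_uniq.
- rewrite map_inj_uniq ?iota_uniq // => i j /eqP.
  by rewrite eqn_pmul2r // => /eqP.
rewrite mem_filter mem_index_iota /= ltnS; apply/idP/mapP.
  case/andP=> /andP[k_gt0 /dvdnP[j kE]]; subst k => le_j; exists j => //.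
  by move: k_gt0 le_j; rewrite mem_index_iota muln_gt0 leq_pmul2r // ltnS => /andP[->].
case=> j; rewrite mem_index_iota ltnS => /andP[j_gt0 le_j] ->.
by rewrite muln_gt0 j_gt0 q_gt0 dvdn_mull //= leq_pmul2r.
Qed.

Section FinFieldPowerSums.

Variable F : finFieldType.
Implicit Types (x : F) (f : {poly F}).

Lemma expf_card_pred x : x ^+ #|F|.-1 = (x != 0)%:R.
Proof.
have F_gt1 := card_finRing_gt1 F.
case: eqVneq => [->|x_neq0]; first by rewrite expr0n eqn0Ngt -ltnS prednK ?F_gt1 // ltnW.
by apply: (mulfI x_neq0); rewrite mulr1 -exprS prednK ?expf_card // ltnW.
Qed.

(** Translation by 1 permutes [F], so adding 1 to every element leaves the total unchanged. *)
Lemma natr_card_finField : #|F|%:R = 0 :> F.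
Proof.
have: \sum_(x : F) (x + 1) = \sum_(x : F) x by rewrite [RHS](reindex_inj (@addIr F 1)).
rewrite big_split /= sumr_const => /eqP.
by rewrite -subr_eq0 addrAC subrr add0r => /eqP.
Qed.

(** For [k] nonzero, scaling by some [x != 0] with [x ^+ k != 1] permutes [F] and multiplies the sum
    by [x ^+ k], so the sum vanishes. *)
Lemma sum_expf_eq0 k : (k == 0%N) || ~~ (#|F|.-1 %| k)%N -> \sum_(x : F) x ^+ k = 0.
Proof.
case: eqP => [-> _|_ /= ndvd].
  by under eq_bigr do rewrite expr0; rewrite sumr_const natr_card_finField.
have F_gt1 := card_finRing_gt1 F.
have Fp_gt0 : (0 < #|F|.-1)%N by rewrite -ltnS prednK // ltnW.
(* Otherwise all [#|F|.-1] nonzero elements would be roots of unity of order [k %% #|F|.-1], a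
   positive number below [#|F|.-1]: too many roots. *)
have [x /andP[x_neq0 xk]] : exists x : F, (x != 0) && (x ^+ k != 1).
  apply/existsP/contraT; rewrite negb_exists => /forallP all1.
  pose rs := enum [set x : F | x != 0].
  have r_gt0 : (0 < k %% #|F|.-1)%N by rewrite lt0n.
  have rs_roots : all (k %% #|F|.-1).-unity_root rs.
    apply/allP => x; rewrite mem_enum inE => x_neq0; rewrite unity_rootE.
    have := all1 x; rewrite x_neq0 /= negbK {1}(divn_eq k #|F|.-1) exprD mulnC exprM.
    by rewrite expf_card_pred x_neq0 expr1n mul1r.
  have := max_unity_roots r_gt0 rs_roots (enum_uniq _).
  rewrite -cardE [X in (X <= _)%N](_ : _ = #|F|.-1); last first.
    have -> : [set x : F | x != 0] = ~: [set 0] by apply/setP => x; rewrite !inE.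
    by rewrite cardsC1.
  by rewrite leqNgt ltn_pmod.
have : x ^+ k * \sum_(y : F) y ^+ k = \sum_(y : F) y ^+ k.
  rewrite [RHS](reindex_inj (mulfI x_neq0)) mulr_sumr.
  by apply: eq_bigr => y _; rewrite exprMn.
by move/eqP; rewrite -subr_eq0 -[X in _ - X]mul1r -mulrBl mulf_eq0 subr_eq0 (negPf xk) => /eqP.
Qed.

Lemma sum_expf_dvd k : (0 < k)%N -> (#|F|.-1 %| k)%N -> \sum_(x : F) x ^+ k = - 1.
Proof.
move=> k_gt0 /dvdnP[m kE].
have m_gt0 : (0 < m)%N by case: m kE k_gt0 => // ->.
rewrite kE mulnC; under eq_bigr do rewrite exprM expf_card_pred.
rewrite (bigD1 0) //= eqxx expr0n eqn0Ngt m_gt0 add0r.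
under eq_bigr => x x_neq0 do rewrite x_neq0 expr1n.
rewrite sumr_const; apply/eqP; rewrite -addr_eq0; apply/eqP.
rewrite -[RHS]natr_card_finField -mulrSr [in RHS](cardD1 (0 : F)) inE add1n.
by congr (_.+1%:R); apply: eq_card => x; rewrite !inE andbT.
Qed.

(** By Fermat, the power of [f.[x]] is the indicator of a non-root; roots and non-roots together
    number [#|F|], which is 0 in [F]. *)
Lemma natr_card_roots f :
  #|[set x | root f x]|%:R = - \sum_(x : F) (f ^+ #|F|.-1).[x].
Proof.
under eq_bigr => x _ do rewrite horner_exp expf_card_pred.
apply/eqP; rewrite -addr_eq0 -sumr_const big_mkcond -big_split /=; apply/eqP.
rewrite -[RHS]natr_card_finField -sumr_const; apply: eq_bigr => x _.
by rewrite inE /root; case: eqP => _; rewrite ?addr0 ?add0r.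
Qed.

(** Swapping the two sums leaves one power sum per coefficient. Exponent 0 drops out although
    [#|F|.-1] divides it, since its power sum is [#|F|], that is 0. *)
Lemma sum_horner_coef f n : (size f <= n)%N ->
  \sum_(x : F) f.[x] = - \sum_(0 <= k < n | (0 < k)%N && (#|F|.-1 %| k)%N) f`_k.
Proof.
move=> size_f; under eq_bigr => x _ do rewrite (horner_coef_wide x size_f).
rewrite exchange_big /= big_mkord -sumrN [RHS]big_mkcond /=.
apply: eq_bigr => k _; rewrite -mulr_sumr.
case: ifP => [/andP[k_gt0 dvd_k]|/negbT]; first by rewrite sum_expf_dvd // mulrN1.
by rewrite negb_and -eqn0Ngt => /sum_expf_eq0->; rewrite mulr0.
Qed.

Lemma natr_card_roots_cubic f : f \is monic -> size f = 4%N ->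
  let g := f ^+ #|F|.-1 in
  #|[set x | root f x]|%:R = 1 + g`_(#|F|.-1) + g`_(2 * #|F|.-1).
Proof.
move=> f_monic size_f g.
have q_gt0 : (0 < #|F|.-1)%N by rewrite -ltnS prednK ?card_finRing_gt1 // ltnW ?card_finRing_gt1.
have g_monic : g \is monic by apply: monic_exp.
have size_g : size g = (3 * #|F|.-1).+1.
  by rewrite -[LHS]prednK ?size_exp ?size_f // size_poly_gt0 monic_neq0.
rewrite natr_card_roots (@sum_horner_coef _ (3 * #|F|.-1).+1) ?size_g // opprK.
have lead_g : g`_(3 * #|F|.-1) = 1 by rewrite -(monicP g_monic) /lead_coef size_g.
(* The degree is [3 * #|F|.-1], so just three positive multiples of [#|F|.-1] remain, the last
   giving the leading coefficient 1. *)
rewrite big_nat_dvd // /index_iota !big_cons big_nil mul1n addr0 -/g lead_g.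
by rewrite addrA addrC addrA.
Qed.

End FinFieldPowerSums.

Theorem proposition17 (p : nat) (a b : int) (p_prime : prime p)
    (p_ge5 : (5 <= p)%N) :
  let R : nat := #|[set x : 'F_p | x ^+ 3 + a%:~R * x + b%:~R == 0]| in
  let abar : int := (a %% p)%Z in
  let bbar : int := (b %% p)%Z in
  let Q : int := 2 ^+ (p ^ 2)%N in
  let H : int := (Q ^+ 3 + abar * Q + bbar) ^+ (p - 1)%N in
  R%:Z = ((1 + ((H %/ Q ^+ (p - 1)%N)%Z %% Q)%Z
             + ((H %/ Q ^+ (2 * (p - 1))%N)%Z %% Q)%Z) %% p)%Z.
Proof.
have p_gt0 := prime_gt0 p_prime.
have p_neq0 : p%:Z != 0 by rewrite eqz_nat -lt0n.
have lift_mod c : exists2 n : nat, (n < p)%N & (c %% p)%Z = n%:Z /\ c%:~R = n%:R :> 'F_p.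
  have := modz_ge0 c p_neq0; have := ltz_pmod c (p_gt0 : 0 < p%:Z).
  case E: (c %% p)%Z => [n|//] lt_np _; exists n => //; split=> //.
  by rewrite (divz_eq c p) E intrD intrM -[p%:~R]/(p%:R) pchar_Fp_0 // mulr0 add0r.
have [A lt_Ap [aE aFE]] := lift_mod a.
have [B lt_Bp [bE bFE]] := lift_mod b.
move=> R abar bbar Q H.
pose f : {poly nat} := 'X^3 + A%:P * 'X + B%:P.
pose q : nat := (2 ^ (p ^ 2))%N.
have QE : Q = q%:Z by rewrite /Q /q -natrX natz.
have fE n : f.[n] = (n ^ 3 + A * n + B)%N.
  by rewrite !hornerD hornerMX !hornerC hornerXn natrXE.
have HE : H = (f ^+ (p - 1)).[q]%:Z.
  by rewrite horner_exp fE natrXE /H QE /abar /bbar aE bE -!natz !natrX !natrD !natrM !natrX.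
have coef_lt k : (((f ^+ (p - 1))`_k)%R < q)%N.
  apply: leq_ltn_trans (coef_le_horner1 _ _) _; rewrite horner_exp fE natrXE.
  rewrite exp1n muln1 /q.
  (* The left side is [f.[1]], at most [2 * p]. Its power is then at most [2 ^ (p * (p - 1))], below
     [2 ^ (p ^ 2)]. *)
  have base_le : (1 + A + B <= 2 ^ p)%N.
    apply: (@leq_trans (p + p)); first by rewrite add1n leq_add // ltnW.
    by rewrite -(prednK p_gt0) expnS mul2n -addnn leq_add // ltn_expl.
  apply: (@leq_ltn_trans ((2 ^ p) ^ (p - 1))); first by rewrite leq_exp2r ?subn_gt0 ?prime_gt1.
  by rewrite -expnM ltn_exp2l // ltn_pmul2l // subn1 prednK.
have digit k : ((H %/ Q ^+ k)%Z %% Q)%Z = Posz ((f ^+ (p - 1))`_k)%R.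
  have -> : Q ^+ k = (q ^ k)%N%:Z by rewrite QE -!natz natrX.
  by rewrite HE QE divz_nat modz_nat horner_digit.
rewrite !digit -!PoszD modz_nat; congr Posz.
(* Reduction mod [p] as a semiring morphism commutes with powers of polynomials, so it carries the
   digits to the coefficients over [F]. *)
pose F := 'F_p; pose phi : {rmorphism nat -> F} := GRing.natmul 1.
pose fF : {poly F} := map_poly phi f.
have fFE : fF = 'X^3 + (A%:R%:P * 'X + B%:R%:P).
  by rewrite /fF !rmorphD rmorphM /= map_polyXn map_polyX !map_polyC addrA.
have size_low : (size (A%:R%:P * 'X + B%:R%:P : {poly F})%R < 4)%N.
  apply: leq_ltn_trans (size_polyD _ _) _; rewrite gtn_max.
  rewrite mul_polyC (leq_ltn_trans (size_scale_leq _ _)) ?size_polyX //.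
  by rewrite (leq_ltn_trans (size_polyC_leq1 _)).
have size_fF : size fF = 4%N by rewrite fFE size_polyDl ?size_polyXn.
have fF_monic : fF \is monic.
  by apply/monicP; rewrite fFE lead_coefDl ?size_polyXn // lead_coefXn.
have RE : R = #|[set x | root fF x]|.
  apply: eq_card => x; rewrite !inE /root fFE aFE bFE.
  by rewrite !hornerE.
(* A cubic has at most 3 roots and [3 < p], so the congruence mod [p] determines [R] itself. *)
have R_le3 : (R <= 3)%N.
  rewrite RE cardE -ltnS -size_fF max_poly_roots ?enum_uniq ?monic_neq0 //.
  by apply/allP => x; rewrite mem_enum inE.
have := natr_card_roots_cubic _ _ fF_monic size_fF.
rewrite /= -RE card_Fp // -subn1 -rmorphXn !coef_map /= -[1]/(1%:R) -!natrD.
move/(congr1 val); rewrite /= !val_Fp_nat // modn_small //.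
exact: leq_ltn_trans R_le3 (ltnW p_ge5).
Qed.
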